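(* Let $F$ be a forest (a simple graph without cycles). Then $\mathrm{ex}^u_e(F,n)\ll n$.
   Context: A hypergraph $H=(E_i:i\in I)$ is a finite list of finite nonempty subsets of $\mathbb{N}$; it is simple if its edges are pairwise distinct; $v(H)=|\bigcup_iE_i|$, $e(H)=|I|$. In the unordered sense, $H$ contains $H'=(E'_i:i\in I')$ if there exist an injection (not necessarily increasing) $\phi:\bigcup H'\to\bigcup H$ and an injection $f:I'\to I$ with $v\in E'_i\Rightarrow\phi(v)\in E_{f(i)}$. $\mathrm{ex}^u_e(F,n)$ is the maximum of $e(H)$ over simple hypergraphs $H$ with $v(H)\le n$ not containing $F$ in the unordered sense. $f\ll g$ means $|f(n)|<c|g(n)|$ for a constant $c>0$ and all large $n$. *)

(* Defs.v *)
From HB Require Import structures.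
From mathcomp Require Import all_boot all_order all_algebra finmap.
From mathcomp Require Import boolp classical_sets reals.

Set Implicit Arguments.
Unset Strict Implicit.
Unset Printing Implicit Defensive.

Import Order.TTheory GRing.Theory Num.Theory.

(* The index set of the list is 'I_(e H); repeated edges are allowed. *)
Record hypergraph := Hypergraph {
  edges : seq {fset nat};
  _ : fset0 \notin edges
}.

Definition e (H : hypergraph) : nat := size (edges H).

Definition edge (H : hypergraph) (i : 'I_(e H)) : {fset nat} :=
  nth fset0 (edges H) i.

Definition vertices (H : hypergraph) : {fset nat} :=
  (\bigcup_(E <- edges H) E)%fset.

Definition v (H : hypergraph) : nat := #|` vertices H|.

Definition simple (H : hypergraph) : Prop := uniq (edges H).

Definition ucontains (H H' : hypergraph) : Prop :=
  exists (phi : vertices H' -> vertices H) (f : 'I_(e H') -> 'I_(e H)),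
    [/\ injective phi, injective f &
        forall (i : 'I_(e H')) (x : vertices H'),
          val x \in edge i -> val (phi x) \in edge (f i)].

Definition simple_graph (F : hypergraph) : Prop :=
  simple F /\ (forall E, E \in edges F -> #|` E| = 2).

Definition adjacent (F : hypergraph) : rel nat :=
  fun x y => [fset x; y]%fset \in edges F.

Definition forest (F : hypergraph) : Prop :=
  simple_graph F /\
  (forall c : seq nat, 3 <= size c -> ~ ucycle (adjacent F) c).

Definition maximum (A : set nat) (m : nat) : Prop :=
  A m /\ (forall k, A k -> k <= m).

Definition avoiding_sizes (F : hypergraph) (n : nat) : set nat :=
  fun m => exists H : hypergraph,
    [/\ simple H, v H <= n, ~ ucontains H F & e H = m].

(* The maximum exists unless F has no edges (see ex_ueP); in that degenerate
   case every H contains F and the value is 0 by convention. *)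
Definition ex_ue (F : hypergraph) (n : nat) : nat :=
  xget 0 (maximum (avoiding_sizes F n)).

Definition ll (R : realType) (f g : nat -> R) : Prop :=
  exists c : R, (0 < c)%R /\
    exists N : nat, forall n : nat, N <= n -> (`|f n| < c * `|g n|)%R.

Lemma simple_e_le (H : hypergraph) : simple H -> e H <= 2 ^ v H.
Proof.
move=> sH; rewrite /v -card_fpowerset; apply: uniq_leq_size => // E EH.
by rewrite fpowersetE; apply: bigfcup_sup.
Qed.

Lemma ex_ueP (F : hypergraph) (n : nat) :
  0 < e F -> maximum (avoiding_sizes F n) (ex_ue F n).
Proof.
move=> F0; have nil0 : fset0 \notin ([::] : seq {fset nat}) by [].
have A0 : exists m, `[< avoiding_sizes F n m >].
  exists 0; apply/asboolP; exists (Hypergraph nil0); split=> //.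
    by rewrite /v /vertices big_nil cardfs0.
  by case=> [phi [f _]]; case: (f (Ordinal F0)).
have Ab m : `[< avoiding_sizes F n m >] -> m <= 2 ^ n.
  move=> /asboolP[H [sH vH _ <-]]; apply: (leq_trans (simple_e_le sH)).
  by rewrite leq_exp2l.
case: (ex_maxnP A0 Ab) => m /asboolP Am mmax.
apply: (@xgetPex _ 0 (maximum (avoiding_sizes F n))).
by exists m; split=> // k Ak; apply: mmax; apply/asboolP.
Qed.

(* Main.v *)
Require Import Defs.
From mathcomp Require Import all_boot all_algebra finmap.
From mathcomp Require Import classical_sets reals.

(** Repeatedly deleting a vertex of degree less than [d], together with the
    edges through it, turns a simple hypergraph with more than [d n] edges on
    [n] vertices into a nonempty one of minimum degree at least [d]. Such a
    hypergraph contains the forest [F] as soon as [d >= e(F) + 2 ^ v(F)]: embed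
    [F] leaf by leaf. When the neighbour of the new leaf has been sent to [u],
    at most [e(F) - 1] of the edges through [u] are already used and at most
    [2 ^ v(F)] of them consist of used vertices only, so some unused edge
    through [u] contains a fresh vertex, to which the leaf is sent. *)

Set Implicit Arguments.
Unset Strict Implicit.
Unset Printing Implicit Defensive.

Import GRing.Theory Num.Theory.
Local Open Scope fset_scope.

Definition acyclic (T : eqType) (r : rel T) : Prop :=
  forall c : seq T, 3 <= size c -> ~ ucycle r c.

Lemma sub_acyclic (T : eqType) (r r' : rel T) :
  subrel r r' -> acyclic r' -> acyclic r.
Proof.
move=> rr' r'_acyclic c size_c /andP[r_c c_uniq].
by apply: (r'_acyclic c size_c); rewrite /ucycle c_uniq (sub_cycle rr').
Qed.

Section MaximalPath.

Variables (T : eqType) (r : rel T) (A : seq T).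
Hypothesis dom_r : forall x y, r x y -> x \in A.

Lemma exists_maximal_upath (x : T) (p : seq T) :
    {subset x :: p <= A} -> path r x p -> uniq (x :: p) ->
  exists z q, [/\ path r z q, uniq (z :: q), size p <= size q
                & forall t, r t z -> t \in z :: q].
Proof.
have [n] := ubnP (size A - size p).
elim: n x p => // n IHn x p size_lt xpA r_xp xp_uniq.
have [/hasP[t tA /andP[rtx tNxp]]|no_ext] :=
    boolP (has (fun t => r t x && (t \notin x :: p)) A); last first.
  exists x, p; split=> // t rtx; apply: contraNT no_ext => tNxp.
  by apply/hasP; exists t; [exact: dom_r rtx | rewrite rtx].
have txpA : {subset t :: x :: p <= A} by move=> z /predU1P[->|/xpA].
have txp_uniq : uniq (t :: x :: p) by rewrite cons_uniq tNxp.
have /= ltpA := uniq_leq_size txp_uniq txpA.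
have [||z [q [r_zq zq_uniq leq_q max_q]]] := IHn t (x :: p) _ txpA _ txp_uniq.
- by rewrite /= subnS -ltnS prednK // subn_gt0 ltnW.
- by rewrite /= rtx.
by exists z, q; split=> //; apply: ltnW.
Qed.

End MaximalPath.

Section AcyclicLeaf.

Variables (T : eqType) (r : rel T).
Hypotheses (r_sym : symmetric r) (r_irr : irreflexive r).
Hypothesis r_acyclic : acyclic r.

Lemma acyclic_upath_chordless (x y z : T) (p : seq T) :
    path r x (y :: p) -> uniq (x :: y :: p) -> z \in x :: y :: p -> r x z ->
  z = y.
Proof.
move=> r_xyp xyp_uniq; rewrite !inE => /or3P[/eqP->|/eqP//|zp rxz].
  by rewrite r_irr.
case/splitPr: zp r_xyp xyp_uniq => p1 p2; rewrite -cat_rcons.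
rewrite -!cat_cons cat_path cat_uniq => /andP[r_xyp1z _] /andP[xyp1z_uniq _].
case: (r_acyclic (c := x :: y :: rcons p1 z)); first by rewrite /= size_rcons.
by rewrite /ucycle xyp1z_uniq andbT (cycle_path x) /= last_rcons r_sym rxz.
Qed.

Lemma acyclic_exists_leaf (A : seq T) (a b : T) :
    (forall x y, r x y -> x \in A) -> r a b ->
  exists x y, r x y /\ forall z, r x z -> z = y.
Proof.
move=> dom_r rab.
have aNb : a != b by apply: contraTneq rab => ->; rewrite r_irr.
have abA : {subset [:: a; b] <= A}.
  move=> z; rewrite !inE => /pred2P[] ->; first exact: dom_r rab.
  by apply: (dom_r b a); rewrite r_sym.
have [||x [p [+ + + max_xp]]] := exists_maximal_upath dom_r abA.
- by rewrite /= rab.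
- by rewrite /= inE aNb.
case: p max_xp => // y p max_xyp r_xyp xyp_uniq _.
exists x, y; split=> [|z rxz]; first by case/andP: r_xyp.
apply: (acyclic_upath_chordless r_xyp xyp_uniq) => //.
by rewrite max_xyp // r_sym.
Qed.

End AcyclicLeaf.

Section GraphFamilies.

Variable T : choiceType.
Implicit Type G : {fset {fset T}}.

Definition graph G : Prop := {in G, forall E, #|` E| = 2}.

Definition edge_rel G : rel T := fun x y => [fset x; y] \in G.

Lemma edge_rel_sym G : symmetric (edge_rel G).
Proof. by move=> x y; rewrite /edge_rel fsetUC. Qed.

Lemma edge_rel_irr G : graph G -> irreflexive (edge_rel G).
Proof.
by move=> G2 x; apply/negP => /G2; rewrite fsetUid cardfs1.
Qed.

Lemma cardfs2P (A : {fset T}) :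
  reflect (exists x y, x != y /\ A = [fset x; y]) (#|` A| == 2).
Proof.
apply: (iffP eqP) => [A2|[x [y [xNy ->]]]]; last by rewrite cardfs2 xNy.
have /fset0Pn[x xA] : A != fset0 by rewrite -cardfs_gt0 A2.
move: A2; rewrite (cardfsD1 x) xA => -[/eqP/cardfs1P[y Axy]].
exists x, y; split; last by rewrite -(fsetD1K xA) Axy.
by have := fset11 y; rewrite -Axy in_fsetD1 eq_sym => /andP[].
Qed.

Lemma graph_edgeP G E x :
  graph G -> E \in G -> x \in E -> exists2 y, edge_rel G x y & E = [fset x; y].
Proof.
move=> G2 EG; have /eqP/cardfs2P[a [b [_ EE]]] := G2 _ EG.
have abG : edge_rel G a b by rewrite /edge_rel -EE.
rewrite EE => /fset2P[] ->; first by exists b.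
by exists a; rewrite 1?edge_rel_sym // fsetUC.
Qed.

Lemma acyclic_graph_leaf G :
    graph G -> acyclic (edge_rel G) -> G != fset0 ->
  exists x y, [/\ x != y, [fset x; y] \in G
                & {in G, forall E, x \in E -> E = [fset x; y]}].
Proof.
move=> G2 G_acyclic /fset0Pn[E EG].
have /eqP/cardfs2P[a [b [_ EE]]] := G2 _ EG.
have dom_G x y : edge_rel G x y -> x \in \bigcup_(E <- G) E.
  by move=> xyG; apply/bigfcupP; exists [fset x; y]; rewrite ?andbT ?fset21.
have abG : edge_rel G a b by rewrite /edge_rel -EE.
have [x [y [xyG leaf]]] :=
  acyclic_exists_leaf (@edge_rel_sym G) (edge_rel_irr G2) G_acyclic dom_G abG.
exists x, y; split=> // [|E' E'G xE'].
  by apply: contraTneq xyG => ->; rewrite edge_rel_irr.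
by have [z xzG ->] := graph_edgeP G2 E'G xE'; rewrite (leaf z).
Qed.

End GraphFamilies.

Section Star.

Variable U : choiceType.
Implicit Types (L M S : {fset {fset U}}) (V W X : {fset U}).

Definition star M (u : U) : {fset {fset U}} := [fset E in M | u \in E].

Lemma leq_card_star M W u : M `<=` fpowerset W -> #|` star M u| <= 2 ^ #|` W|.
Proof.
move=> MW; rewrite -card_fpowerset fsubset_leq_card //.
by apply: fsubset_trans MW; apply: fset_sub.
Qed.

Lemma card_induced_star L V x :
  #|` L `&` fpowerset V| =
    (#|` star (L `&` fpowerset V) x| + #|` L `&` fpowerset (V `\ x)|)%N.
Proof.
have -> : L `&` fpowerset (V `\ x) =
    (L `&` fpowerset V) `\` star (L `&` fpowerset V) x.
  apply/fsetP => E; rewrite !inE !fpowersetE fsubsetD1.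
  by case: (E \in L) (E `<=` V) (x \in E) => [] [] [].
by rewrite -(cardfsID (star (L `&` fpowerset V) x)) (fsetIidPr (fset_sub _ _)).
Qed.

Lemma exists_min_degree (d : nat) L V :
    d * #|` V| < #|` L `&` fpowerset V| ->
  exists W, [/\ W `<=` V, L `&` fpowerset W != fset0
              & {in W, forall u, d <= #|` star (L `&` fpowerset W) u|}].
Proof.
elim/finSet_rect: V => V IHV dense.
have [/allP V_deg|/allPn[x xV]] :=
    boolP (all (fun u => d <= #|` star (L `&` fpowerset V) u|) V).
  by exists V; split=> //; rewrite -cardfs_gt0; apply: leq_ltn_trans dense.
rewrite -ltnNge => /ltnW x_deg.
have card_V : #|` V| = #|` V `\ x|.+1 by rewrite (cardfsD1 x) xV.
have [|W [WV W_ne W_deg]] := IHV _ (fproperD1 xV).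
  rewrite -(ltn_add2l d) -mulnS -card_V.
  by apply: leq_trans dense _; rewrite (card_induced_star L V x) leq_add2r.
by exists W; split=> //; apply: fsubset_trans WV (fsubD1set _ _).
Qed.

Lemma exists_fresh_edge M S X u :
    #|` S| + 2 ^ #|` X| < #|` star M u| ->
  exists E w, [/\ E \in M, E \notin S, u \in E, w \in E & w \notin X].
Proof.
move=> u_deg; have : ~~ (star M u `<=` S `|` fpowerset X).
  apply: contraL u_deg => /fsubset_leq_card u_le; rewrite -leqNgt.
  by apply: leq_trans u_le _; rewrite -card_fpowerset leq_card_fsetU.
case/fsubsetPn => E; rewrite !inE fpowersetE => /andP[EM uE].
by rewrite negb_or => /andP[ES /fsubsetPn[w wE wX]]; exists E, w.
Qed.

End Star.

Section Injections.

Variables T U : choiceType.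
Implicit Types (A : {fset T}) (B : {fset U}) (f : T -> U).

Definition injects f A B : Prop :=
  {in A &, injective f} /\ {in A, forall x, f x \in B}.

Lemma injects_sub f A B B' : B `<=` B' -> injects f A B -> injects f A B'.
Proof. by move=> /fsubsetP BB' [f_inj fB]; split=> // x /fB /BB'. Qed.

Lemma exists_injects A B (u0 : U) :
  #|` A| <= #|` B| -> exists f, injects f A B.
Proof.
move=> AB; exists (fun x => nth u0 B (index x A)).
have ltB x : x \in A -> index x A < size B.
  by move=> xA; apply: leq_trans AB; rewrite index_mem.
split=> [x y xA yA /eqP|x xA]; last by rewrite mem_nth ?ltB.
rewrite nth_uniq ?ltB ?fset_uniq // => /eqP index_xy.
by rewrite -(nth_index x xA) index_xy nth_index.
Qed.

Lemma injects_with f A B x u :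
    injects f (A `\ x) B -> u \in B -> u \notin f @` (A `\ x) ->
  injects [eta f with x |-> u] A B.
Proof.
move=> [f_inj fB] uB u_fresh.
have AD a : a \in A -> a != x -> a \in A `\ x by rewrite in_fsetD1 => -> ->.
have fNu a : a \in A -> a != x -> f a != u.
  by move=> aA ax; apply: contraNneq u_fresh => <-; rewrite in_imfset ?AD.
split=> [a b aA bA|a aA] /=; last by case: eqVneq => // /(AD _ aA)/fB.
have [->|ax] := eqVneq a x; have [->|bx] := eqVneq b x => //.
- by move/esym/eqP; rewrite (negPf (fNu _ bA bx)).
- by move/eqP; rewrite (negPf (fNu _ aA ax)).
- by apply: f_inj; apply: AD.
Qed.

End Injections.

Section Embeddings.

Variables T U : choiceType.
Implicit Types (G : {fset {fset T}}) (V : {fset T}).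
Implicit Types (M : {fset {fset U}}) (W : {fset U}).
Implicit Types (phi : T -> U) (f : {fset T} -> {fset U}).

Definition embeds phi f G V M W : Prop :=
  [/\ injects phi V W, injects f G M
    & {in G, forall E, {in E, forall x, phi x \in f E}}].

Lemma embeds_sub phi f G V M M' W W' :
  M `<=` M' -> W `<=` W' -> embeds phi f G V M W -> embeds phi f G V M' W'.
Proof.
move=> MM' WW' [phi_inj f_inj phi_f].
by split=> //; [exact: injects_sub phi_inj | exact: injects_sub f_inj].
Qed.

Lemma embeds_with_leaf phi f G V M W x y D w :
    {in G, forall E, x \in E -> E = [fset x; y]} -> x != y ->
    embeds phi f (G `\ [fset x; y]) (V `\ x) M W ->
    D \in M -> D \notin f @` (G `\ [fset x; y]) -> phi y \in D ->
    w \in D -> w \in W -> w \notin phi @` (V `\ x) ->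
  embeds [eta phi with x |-> w] [eta f with [fset x; y] |-> D] G V M W.
Proof.
move=> leaf xNy [phi_inj f_inj phi_f] DM D_fresh yD wD wW w_fresh.
split=> [||E EG z zE /=]; [exact: injects_with | exact: injects_with |].
have [EE|ExNy] := eqVneq E [fset x; y].
  by move: zE; rewrite EE => /fset2P[] ->; rewrite ?eqxx // eq_sym (negPf xNy).
have zNx : z != x.
  by apply: contraNneq ExNy => zx; apply/eqP/leaf; rewrite // -zx.
by rewrite (negPf zNx); apply: phi_f; rewrite // in_fsetD1 ExNy.
Qed.

Section MinDegree.

Variables (d : nat) (M : {fset {fset U}}) (W : {fset U}).
Hypotheses (MW : M `<=` fpowerset W) (W_ne : W != fset0).
Hypothesis W_deg : {in W, forall u, d <= #|` star M u|}.

Lemma exists_embedding_without_edges V :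
  2 ^ #|` V| <= d -> exists phi f, embeds phi f fset0 V M W.
Proof.
move=> Vd; have /fset0Pn[u uW] := W_ne.
(* The edges through [u] are at least [2 ^ #|` V|] subsets of [W]. *)
have [|phi phi_inj] := @exists_injects _ _ V W u.
  rewrite -(@leq_exp2l 2) // (leq_trans Vd) // (leq_trans (W_deg uW)) //.
  exact: leq_card_star.
by exists phi, (fun=> fset0).
Qed.

Lemma exists_embedding_with_leaf phi f G V x y :
    {in G, forall E, x \in E -> E = [fset x; y]} -> x != y -> y \in V ->
    embeds phi f (G `\ [fset x; y]) (V `\ x) M W ->
    #|` G `\ [fset x; y]| + 2 ^ #|` V `\ x| < d ->
  exists phi' f', embeds phi' f' G V M W.
Proof.
move=> leaf xNy yV emb d_large; have [[_ phiW] _ _] := emb.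
have phi_yW : phi y \in W by rewrite phiW // in_fsetD1 eq_sym xNy.
have [|D [w [DM D_fresh yD wD w_fresh]]] :=
    @exists_fresh_edge _ M (f @` (G `\ [fset x; y])) (phi @` (V `\ x)) (phi y).
  apply: leq_trans (W_deg phi_yW); apply: leq_ltn_trans d_large.
  by rewrite leq_add ?leq_exp2l ?leq_imfset_card.
exists [eta phi with x |-> w], [eta f with [fset x; y] |-> D].
apply: embeds_with_leaf => //.
by have := fsubsetP MW _ DM; rewrite fpowersetE => /fsubsetP; apply.
Qed.

Lemma exists_acyclic_embedding G V :
    graph G -> acyclic (edge_rel G) -> G `<=` fpowerset V ->
    #|` G| + 2 ^ #|` V| <= d ->
  exists phi f, embeds phi f G V M W.
Proof.
elim/finSet_rect: G V => G IHG V G2 G_acyclic GV d_large.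
have [G0|G_ne] := eqVneq G fset0.
  rewrite G0; apply: exists_embedding_without_edges.
  exact: leq_trans (leq_addl _ _) d_large.
have [x [y [xNy xyG leaf]]] := acyclic_graph_leaf G2 G_acyclic G_ne.
have yV : y \in V.
  have := fsubsetP GV _ xyG; rewrite fpowersetE => /fsubsetP; apply.
  exact: fset22.
have G'G : G `\ [fset x; y] `<=` G by apply: fsubD1set.
have d_larger : #|` G `\ [fset x; y]| + 2 ^ #|` V `\ x| < d.
  apply: leq_trans d_large; rewrite (cardfsD1 [fset x; y] G) xyG.
  rewrite -addnA add1n ltnS leq_add2l leq_exp2l //.
  by rewrite fsubset_leq_card ?fsubD1set.
have [E /(fsubsetP G'G)/G2||||phi [f emb]] // := IHG _ (fproperD1 xyG) (V `\ x).
- by apply: sub_acyclic G_acyclic => a b; apply: (fsubsetP G'G).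
- apply/fsubsetP => E; rewrite in_fsetD1 fpowersetE fsubsetD1 => /andP[ExNy EG].
  rewrite -fpowersetE (fsubsetP GV) //=.
  by apply: contraNN ExNy => xE; apply/eqP/leaf.
- exact: ltnW.
exact: exists_embedding_with_leaf emb d_larger.
Qed.

End MinDegree.

End Embeddings.

Definition edge_set (H : hypergraph) : {fset {fset nat}} := [fset E in edges H].

Lemma card_edge_set (H : hypergraph) : simple H -> #|` edge_set H| = e H.
Proof. by move=> H_simple; rewrite card_fseq undup_id. Qed.

Lemma edge_set_sub (H : hypergraph) : edge_set H `<=` fpowerset (vertices H).
Proof.
by apply/fsubsetP => E; rewrite !inE fpowersetE => EH; apply: bigfcup_sup.
Qed.

Lemma embeds_ucontains (H F : hypergraph) phi f :
    simple F ->
    embeds phi f (edge_set F) (vertices F) (edge_set H) (vertices H) ->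
  ucontains H F.
Proof.
move=> F_simple [[phi_inj phiH] [f_inj fH] phi_f].
have edgeF (i : 'I_(e F)) : edge i \in edge_set F by rewrite inE mem_nth.
have f_edge (i : 'I_(e F)) : f (edge i) \in edges H.
  by have := fH _ (edgeF i); rewrite inE.
have lt_eH (i : 'I_(e F)) : index (f (edge i)) (edges H) < e H.
  by rewrite index_mem.
exists (fun x => [` phiH (val x) (valP x)]), (fun i => Ordinal (lt_eH i)).
split.
- by move=> x y /(congr1 val) /= /phi_inj xy; apply/val_inj/xy; apply: valP.
- move=> i j /(congr1 val) /= index_ij.
  have /f_inj : f (edge i) = f (edge j).
    by rewrite -(nth_index fset0 (f_edge i)) index_ij nth_index.
  move/(_ (edgeF i) (edgeF j))/eqP.
  by rewrite nth_uniq // => /eqP/val_inj.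
- by move=> i x xi; rewrite [edge (Ordinal _)]nth_index //=; apply: phi_f.
Qed.

Lemma edge_neq0 (H : hypergraph) E : E \in edge_set H -> E != fset0.
Proof. by case: H => s s0; rewrite inE; apply: contraTneq => ->. Qed.

Lemma forest_ucontains (F H : hypergraph) :
  forest F -> simple H -> (e F + 2 ^ v F) * v H < e H -> ucontains H F.
Proof.
move=> [[F_simple F2] F_acyclic] H_simple dense.
have [|W [WH M_ne W_deg]] :=
    @exists_min_degree _ (e F + 2 ^ v F) (edge_set H) (vertices H).
  by rewrite (fsetIidPl (edge_set_sub H)) card_edge_set.
have W_ne : W != fset0.
  have /fset0Pn[E] := M_ne; rewrite in_fsetI fpowersetE.
  case/andP=> /edge_neq0 E_ne EW.
  by apply: contraNneq E_ne => W0; rewrite -fsubset0 -W0.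
have [E||||phi [f emb]] := exists_acyclic_embedding (fsubsetIr _ _) W_ne W_deg
    (G := edge_set F) (V := vertices F).
- by rewrite inE; apply: F2.
- by apply: sub_acyclic F_acyclic => x y; rewrite /edge_rel inE.
- exact: edge_set_sub.
- by rewrite card_edge_set.
apply: embeds_ucontains F_simple _.
exact: embeds_sub (fsubsetIl _ _) WH emb.
Qed.

Lemma ex_ue_leq (F : hypergraph) (n m : nat) :
    (forall H, simple H -> v H <= n -> ~ ucontains H F -> e H <= m) ->
  ex_ue F n <= m.
Proof.
move=> e_le; rewrite /ex_ue; case: xgetP => // k _ [[H [H_simple vH noF <-]] _].
exact: e_le.
Qed.

Lemma forest_ex_ue_leq (F : hypergraph) (n : nat) :
  forest F -> ex_ue F n <= (e F + 2 ^ v F) * n.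
Proof.
move=> F_forest; apply: ex_ue_leq => H H_simple vH noF.
apply: (@leq_trans ((e F + 2 ^ v F) * v H)); last by rewrite leq_mul2l vH orbT.
by rewrite leqNgt; apply/negP => /(forest_ucontains F_forest H_simple).
Qed.

Theorem theorem4 (R : realType) (F : hypergraph) (hF : forest F) :
  ll (fun n : nat => (ex_ue F n)%:R%R : R) (fun n : nat => n%:R%R : R).
Proof.
exists ((e F + 2 ^ v F).+1%:R)%R; split; first by rewrite ltr0Sn.
exists 1 => n n_gt0; rewrite !normr_nat -natrM ltr_nat.
apply: leq_ltn_trans (forest_ex_ue_leq n hF) _.
by rewrite ltn_pmul2r.
Qed.
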